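(* There is an absolute constant $K>0$ such that the following holds for $k\in\{1,2\}$. Let $n\ge 2$, $V=\{0,1\}^n$, $\mu$ uniform measure on $V$, $\beta=\log_2(3/2)$, $\varepsilon>0$, and let $(A,B,W)$ be a partition of $V$ with $(1-\varepsilon)2^{-k}\le \mu(A)\le(1+\varepsilon)2^{-k}$, $\mu(W)\le \varepsilon n^{-\beta}$, and \[ |\nabla(A,B)|<(1+\varepsilon)k2^{n-k}. \] Then there is $I\subseteq[n]$ with $|I|=k$ such that $|\nabla_i A|\ge (1-K\varepsilon)2^{n-k}$ for all $i\in I$. Furthermore, there is a codimension-$k$ subcube $C$ with $\mu(C\,\Delta\,A)\le K\varepsilon$.
   Context: $V=\{0,1\}^n$ is the vertex set of the Hamming cube $Q_n$ (vertices adjacent iff they differ in exactly one coordinate). For $x\in V$, $x^i$ is obtained from $x$ by flipping coordinate $i$. For disjoint $A,B\subseteq V$, $\nabla(A,B)$ is the set of pairs $(x,y)$ with $x\in A$, $y\in B$, $x,y$ adjacent. $\nabla_i A=\{(x,x^i): x\in A,\ x^i\notin A\}$. A codimension-$k$ subcube is a set $\{x\in V: x_i=z_i\ \forall i\in I\}$ with $|I|=k$, $z\in\{0,1\}^I$. *)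

(* Defs.v *)
From mathcomp Require Import all_boot.
From Stdlib Require Import Reals.

Set Implicit Arguments.
Unset Strict Implicit.
Unset Printing Implicit Defensive.

Definition cube (n : nat) := {ffun 'I_n -> bool}.

Definition flip n (x : cube n) (i : 'I_n) : cube n :=
  [ffun j => if j == i then ~~ x j else x j].

Definition adj n (x y : cube n) : bool := #|[set j | x j != y j]| == 1%N.

Definition edge_boundary n (A B : {set cube n}) : {set cube n * cube n} :=
  [set p | [&& p.1 \in A, p.2 \in B & adj p.1 p.2]].

Definition dir_boundary n (A : {set cube n}) (i : 'I_n) : {set cube n * cube n} :=
  [set p | [&& p.1 \in A, flip p.1 i \notin A & p.2 == flip p.1 i]].

Definition mu n (S : {set cube n}) : R := (INR #|S| / 2 ^ n)%R.

Definition is_subcube_codim n (k : nat) (C : {set cube n}) : Prop :=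
  exists (I : {set 'I_n}) (z : cube n),
    #|I| = k /\ C = [set x : cube n | [forall i in I, x i == z i]].

Definition symdiff (T : finType) (A B : {set T}) : {set T} := (A :\: B) :|: (B :\: A).

Definition beta : R := (ln (3/2) / ln 2)%R.

(* Main.v *)
(**
Flipping a coordinate and averaging gives commuting projections [av i]; write
[avs t] for the composition over the coordinates in [t], [U = A u W] for the
complement of [B], and [beta = log_2 (3/2)].

The inequality [int h_U^beta >= 2 mu(U) (1 - mu(U))] holds in every subcube, by
induction on the dimension.  Vertices of [W] contribute at most
[n^beta mu(W) <= eps], so only the edges from [A] to [B] matter, and the bounds
[d^beta <= d] (k = 1) and [d^beta <= (d + 1) / 2] (k = 2) turn the left-hand
side into the number of such edges.  Applied in two ways, with [c = 2^-k], [p_i]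
the measure of the [A]-[B] edges in direction [i], and [delta_i] the level-one
Fourier coefficients of [1_U], this gives, up to O(eps):
- [c p_i <= delta_i^2], from the two half-cubes in direction [i];
- [k c^2 <= sum_i delta_i^2], from averaging over subcubes whose set of free
  coordinates is uniformly random, because noise of rate 1/2 damps the levels
  above one by a factor at least 4.
Since also [|delta_i| <= p_i + mu(W)], every [p_i] is either O(eps) or
[c - O(eps)].  The small ones contribute O(eps) to [sum_i delta_i^2] (here
[n mu(W)^2 <= eps^2] uses [beta >= 1/2]), so at least [k] directions are large.  In
a large direction [|delta_i|] is nearly [c], which puts [A] almost entirely in
one of the two half-cubes.
*)
Require Import Defs.
From HB Require Import structures.
From mathcomp Require Import all_boot.
From Stdlib Require Import Reals Lra.

Set Implicit Arguments.
Unset Strict Implicit.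
Unset Printing Implicit Defensive.

(* [Reals] rebinds the key [N] to [N_scope]. *)
Delimit Scope nat_scope with N.
Local Open Scope R_scope.

(** * The exponent beta *)

Lemma ln2_gt0 : 0 < ln 2.
Proof. rewrite -ln_1; apply: ln_increasing; lra. Qed.

Lemma ln_homo x y : 0 < x -> x <= y -> ln x <= ln y.
Proof. by move=> x0 [xy|->]; [left; exact: ln_increasing|right]. Qed.

Lemma beta_gt0 : 0 < beta.
Proof.
rewrite /beta; apply: Rdiv_lt_0_compat ln2_gt0.
rewrite -ln_1; apply: ln_increasing; lra.
Qed.

Lemma beta_ge_half : 1 / 2 <= beta.
Proof.
have L := ln2_gt0; rewrite /beta; apply: (Rmult_le_reg_r (ln 2)) => //.
rewrite /Rdiv Rmult_assoc [_ * / ln 2 * _]Rmult_assoc Rinv_l; last lra.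
have := @ln_homo 2 ((3 / 2) ^ 2); rewrite ln_pow; [|lra] => /= H.
have {H} := H ltac:(lra) ltac:(lra); lra.
Qed.

Lemma beta_le_two_thirds : beta <= 2 / 3.
Proof.
have L := ln2_gt0; rewrite /beta; apply: (Rmult_le_reg_r (ln 2)) => //.
rewrite /Rdiv [_ * / ln 2 * _]Rmult_assoc Rinv_l; last lra.
have := @ln_homo ((3 / 2) ^ 3) (2 ^ 2); rewrite !ln_pow; [|lra|lra] => /= H.
have {H} := H ltac:(lra) ltac:(lra); lra.
Qed.

Lemma Rpower_2_beta : Rpower 2 beta = 3 / 2.
Proof.
rewrite /Rpower /beta /Rdiv Rmult_assoc Rinv_l; last by have := ln2_gt0; lra.
by rewrite Rmult_1_r exp_ln //; lra.
Qed.

Lemma Rpower_gt0 x y : 0 < Rpower x y.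
Proof. exact: exp_pos. Qed.

Lemma Rpower_1l y : Rpower 1 y = 1.
Proof. by rewrite /Rpower ln_1 Rmult_0_r exp_0. Qed.

Lemma Rpower_div x y b : 0 < x -> 0 < y -> Rpower (x / y) b = Rpower x b / Rpower y b.
Proof.
move=> x0 y0; rewrite /Rdiv -Rpower_mult_distr //; last exact: Rinv_0_lt_compat.
by congr (_ * _); rewrite -Rpower_Ropp /Rpower ln_Rinv // Ropp_mult_distr_r_reverse Ropp_mult_distr_l_reverse.
Qed.

(** Weighted AM-GM: with [M = b * x + (1 - b)], add [ln y <= y - 1] at [x / M] and [1 / M] with
    weights [b] and [1 - b]; the right-hand sides cancel. *)
Lemma Rpower_le_linear x b : 0 < x -> 0 <= b <= 1 -> Rpower x b <= 1 + b * (x - 1).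
Proof.
move=> x0 b01; set M := 1 + _; have M0 : 0 < M by rewrite /M; nra.
have lnle y : 0 < y -> ln y <= y - 1.
  move=> y0; have := exp_ineq1_le (ln y); rewrite exp_ln //; lra.
have H1 := lnle (x / M) ltac:(exact: Rdiv_lt_0_compat).
have H2 := lnle (1 / M) ltac:(apply: Rdiv_lt_0_compat; lra).
move: H1 H2; rewrite /Rdiv !ln_mult ?ln_Rinv ?ln_1 //; try lra; try exact: Rinv_0_lt_compat.
move=> H1 H2.
have E : b * (x * / M - 1) + (1 - b) * (1 * / M - 1) = 0.
  by rewrite /M; field; rewrite /M in M0; lra.
rewrite /Rpower -[X in _ <= X]exp_ln //.
suff [?|->] : b * ln x <= ln M by [left; exact: exp_increasing|right].
nra.
Qed.

Lemma Rpower_concave l a b c : 0 < a -> 0 < b -> 0 <= l <= 1 -> 0 <= c <= 1 ->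
  l * Rpower a c + (1 - l) * Rpower b c <= Rpower (l * a + (1 - l) * b) c.
Proof.
move=> a0 b0 l01 c01; set M := l * a + _.
have M0 : 0 < M by rewrite /M; nra.
have P0 := Rpower_gt0 M c.
(* Tangent line at the weighted mean [M]; the linear terms at [a] and [b] cancel in the average. *)
have tangent x : 0 < x -> Rpower x c <= Rpower M c * (1 + c * (x / M - 1)).
  move=> x0; have := @Rpower_le_linear (x / M) c ltac:(exact: Rdiv_lt_0_compat) c01.
  rewrite Rpower_div // => H; apply: (Rmult_le_reg_l (/ Rpower M c)).
    exact: Rinv_0_lt_compat.
  rewrite -Rmult_assoc Rinv_l; last lra.
  by rewrite Rmult_1_l Rmult_comm.
have Ha := tangent _ a0; have Hb := tangent _ b0.
have E : l * (Rpower M c * (1 + c * (a / M - 1))) +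
         (1 - l) * (Rpower M c * (1 + c * (b / M - 1))) = Rpower M c.
  have {3}-> : Rpower M c = Rpower M c * (1 + c * ((l * a + (1 - l) * b) / M - 1)).
    by rewrite -/M; field; lra.
  by field; lra.
nra.
Qed.

(* Dual (Hölder) form of the l^(1/beta) triangle inequality. *)
Lemma Rpower_add_ge l a b c : 0 < a -> 0 < b -> 0 < l < 1 -> 0 <= c <= 1 ->
  Rpower l (1 - c) * Rpower a c + Rpower (1 - l) (1 - c) * Rpower b c
    <= Rpower (a + b) c.
Proof.
move=> a0 b0 l01 c01.
have H := @Rpower_concave l (a / l) (b / (1 - l)) c.
have {H} := H ltac:(apply: Rdiv_lt_0_compat; lra) ltac:(apply: Rdiv_lt_0_compat; lra)
  ltac:(lra) c01.
have -> : l * (a / l) + (1 - l) * (b / (1 - l)) = a + b by field; lra.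
have E m x : 0 < m -> 0 < x -> m * Rpower (x / m) c = Rpower m (1 - c) * Rpower x c.
  move=> m0 x0; rewrite Rpower_div // /Rdiv Rpower_plus Rpower_1 // Rpower_Ropp; ring.
by rewrite !E //; lra.
Qed.

(** Zero needs its own case: [ln 0 = 0], so [Rpower 0 beta] would be 1. *)
Definition pw (d : nat) : R := if d is 0%N then 0 else Rpower (INR d) beta.

Lemma INRS_ge1 d : 1 <= INR d.+1.
Proof. rewrite S_INR; have := pos_INR d; lra. Qed.

Lemma pw_ge0 d : 0 <= pw d.
Proof. by case: d => [|d] /=; [lra|left; exact: Rpower_gt0]. Qed.

Lemma pwS_ge1 d : 1 <= pw d.+1.
Proof.
rewrite /pw -[X in X <= _](Rpower_1l beta); apply: Rle_Rpower_l.
  by have := beta_gt0; lra.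
by have := INRS_ge1 d; lra.
Qed.

Lemma pw_homo (d e : nat) : (d <= e)%N -> pw d <= pw e.
Proof.
case: d => [|d]; first by move=> _; exact: pw_ge0.
case: e => // e de; rewrite /pw; apply: Rle_Rpower_l; first by have := beta_gt0; lra.
have := INRS_ge1 d; split; first lra.
by apply: le_INR; apply/leP.
Qed.

(** Equality holds at 0, 1 and 2, the last because [2^beta = 3/2]. Beyond 2, Bernoulli at [d / 2]
    with slope [beta <= 2/3] stays below the same line. *)
Lemma pw_le_half d : pw d <= (INR d + (if d is 0%N then 0 else 1)) / 2.
Proof.
case: d => [|[|d]]; rewrite /pw; first by rewrite /=; lra.
  by rewrite Rpower_1l /=; lra.
set x := INR _; have x2 : 2 <= x by rewrite /x !S_INR; have := pos_INR d; lra.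
have -> : x = 2 * (x / 2) by field.
rewrite -Rpower_mult_distr; [|lra|lra]; rewrite Rpower_2_beta.
have b1 := beta_gt0; have b2 := beta_le_two_thirds.
have := @Rpower_le_linear (x / 2) beta ltac:(lra) ltac:(lra); nra.
Qed.

Lemma pw_le_id d : pw d <= INR d.
Proof.
have := pw_le_half d; case: d => [|d]; first by rewrite /=; lra.
have := INRS_ge1 d; lra.
Qed.

Lemma pwS_ge l d : 0 < l < 1 ->
  Rpower l (1 - beta) * pw d + Rpower (1 - l) (1 - beta) <= pw d.+1.
Proof.
move=> l01; have b1 := beta_gt0; have b2 := beta_le_two_thirds.
case: d => [|d].
  rewrite /= Rmult_0_r Rplus_0_l Rpower_1l -[X in _ <= X](Rpower_1l (1 - beta)).
  by apply: Rle_Rpower_l; lra.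
have := @Rpower_add_ge l (INR d.+1) 1 beta ltac:(have := INRS_ge1 d; lra) ltac:(lra) l01 ltac:(lra).
by rewrite Rpower_1l Rmult_1_r -S_INR.
Qed.

Lemma Rpower_half_compl : Rpower (1 / 2) (1 - beta) = 3 / 4.
Proof.
rewrite /Rminus Rpower_plus Rpower_1; last lra.
by rewrite Rpower_Ropp Rpower_div ?Rpower_1l ?Rpower_2_beta; lra.
Qed.

(** Weight [l = 1/2] in [pwS_ge] makes both coefficients 3/4; for positive [d], [pw d >= 1] lets a
    quarter of [pw d] pass into the constant. *)
Lemma pwS_ge_half d : pw d / 2 + 1 <= pw d.+1.
Proof.
case: d => [|d]; first by rewrite /= Rpower_1l; lra.
have := @pwS_ge (1 / 2) d.+1 ltac:(lra).
have -> : 1 - 1 / 2 = 1 / 2 by field.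
by rewrite Rpower_half_compl; have := pwS_ge1 d; lra.
Qed.

Lemma Rpower_beta_inv x : 0 < x -> Rpower (Rpower x (/ beta)) beta = x.
Proof.
by move=> x0; rewrite Rpower_mult Rinv_l ?Rpower_1 //; have := beta_gt0; lra.
Qed.

(** The extreme case [D = m] comes from Hölder with equal weights and [m <= 1/2]. Smaller [D] is
    interpolated between 0 and [m]: the left side is affine in [D^2], and the right side is
    controlled by concavity of the power [beta]. *)
Lemma lp_norm_ge m D : 0 < D <= m -> m <= 1 / 2 ->
  2 * m * (1 - m) + D ^ 2 <=
  Rpower (Rpower (2 * m * (1 - m)) (/ beta) + Rpower D (/ beta)) beta.
Proof.
move=> D0 m1; have b1 := beta_gt0; have b2 := beta_le_two_thirds; have b3 := beta_ge_half.
set G := 2 * m * (1 - m); have G0 : 0 < G by rewrite /G; nra.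
have m0 : 0 < m by lra.
set p := / beta; have p2 : 0 < p <= 2.
  split; first exact: Rinv_0_lt_compat.
  have -> : 2 = / (1 / 2) by field.
  by apply: Rinv_le_contravar; lra.
have corner : G + m ^ 2 <= Rpower (Rpower G p + Rpower m p) beta.
  have := @Rpower_add_ge (1 / 2) (Rpower G p) (Rpower m p) beta (Rpower_gt0 _ _)
    (Rpower_gt0 _ _) ltac:(lra) ltac:(lra).
  have -> : 1 - 1 / 2 = 1 / 2 by field.
  rewrite Rpower_half_compl !Rpower_beta_inv //; rewrite /G; nra.
set t := (D / m) ^ 2.
have Dm : 0 < D / m <= 1.
  split; first by apply: Rdiv_lt_0_compat; lra.
  by apply: (Rmult_le_reg_r m) => //; rewrite /Rdiv Rmult_assoc Rinv_l; lra.
have t01 : 0 <= t <= 1 by rewrite /t; nra.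
(* Since [D / m <= 1] and [p <= 2], the square of [D / m] is at most its [p]-th power. *)
have tD : t * Rpower m p <= Rpower D p.
  have -> : Rpower D p = Rpower (D / m) p * Rpower m p.
    by rewrite Rpower_mult_distr //; [congr Rpower; field|]; lra.
  apply: Rmult_le_compat_r; first by left; exact: Rpower_gt0.
  rewrite /t -Rpower_pow; last lra.
  have lnD : ln (D / m) <= 0 by rewrite -ln_1; apply: ln_homo; lra.
  rewrite /Rpower.
  suff [?|->] : INR 2 * ln (D / m) <= p * ln (D / m) by [left; exact: exp_increasing|right].
  by rewrite /=; nra.
have := @Rpower_concave t (Rpower G p + Rpower m p) (Rpower G p) beta
  ltac:(have := Rpower_gt0 G p; have := Rpower_gt0 m p; lra) (Rpower_gt0 _ _) t01 ltac:(lra).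
rewrite Rpower_beta_inv // => H.
apply: Rle_trans (Rle_trans _ _ _ H _).
  have -> : D ^ 2 = t * m ^ 2 by rewrite /t; field; lra.
  have := Rmult_le_compat_l t _ _ (proj1 t01) corner; lra.
apply: Rle_Rpower_l; first lra.
have := Rpower_gt0 G p; have := Rpower_gt0 m p; nra.
Qed.

(* [a0] and [a1] are the densities of [U] in two opposite half-cubes: a vertex
   with [d] boundary edges inside the denser half gains one more as soon as its
   neighbour across lies outside [U], which happens with density at least [a0 - a1]. *)
Lemma two_point a0 a1 : 0 <= a1 <= a0 -> a0 <= 1 ->
  exists al ga, [/\ 0 <= al <= 1, 0 <= ga,
    forall d, al * pw d + ga <= pw d.+1 &
    2 * a0 * (1 - a0) + (a0 - a1) ^ 2 <= al * (2 * a0 * (1 - a0)) + ga * (a0 - a1)].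
Proof.
move=> a10 a01; set D := a0 - a1.
have b1 := beta_gt0; have b2 := beta_le_two_thirds.
have [D0|D0] : D = 0 \/ 0 < D by rewrite /D; lra.
  exists 1, 0; split; try lra; last by rewrite D0 /=; lra.
  by move=> d; have := @pw_homo d d.+1 (leqnSn d); lra.
have [big|small] := Rle_lt_dec (1 - a0) D.
  (* Here [1 - a0 <= D <= a0], so [a0 * (1 - a0) <= D * (1 - D)], which is the required
     inequality. *)
  exists (1 / 2), 1; split; try lra; first by move=> d; have := pwS_ge_half d; lra.
  by rewrite /D in big *; nra.
(* [m] is the smaller of [a0] and [1 - a0]; both exceed or equal [D] in this case. *)
have [m [m12 [Dm Gm]]] : exists m, m <= 1 / 2 /\ 0 < D <= m /\ 2 * a0 * (1 - a0) = 2 * m * (1 - m).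
  have [h|h] := Rle_lt_dec a0 (1 / 2); [exists a0|exists (1 - a0)]; rewrite /D; repeat split; rewrite /D in D0 small; lra.
have N := lp_norm_ge Dm m12; rewrite Gm.
move: N; set G := 2 * m * (1 - m); have G0 : 0 < G by rewrite /G; nra.
set g := Rpower G _; set e := Rpower D _ => N.
have g0 : 0 < g := Rpower_gt0 _ _; have e0 : 0 < e := Rpower_gt0 _ _.
have l01 : 0 < g / (g + e) < 1.
  split; first by apply: Rdiv_lt_0_compat; lra.
  by apply: (Rmult_lt_reg_r (g + e)); [lra|rewrite /Rdiv Rmult_assoc Rinv_l; lra].
(* The weight giving equality in Hölder, so that [al * G + ga * D] is exactly [(g + e)^beta]. *)
exists (Rpower (g / (g + e)) (1 - beta)), (Rpower (1 - g / (g + e)) (1 - beta)); split.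
- split; first by left; exact: Rpower_gt0.
  by rewrite -[X in _ <= X](Rpower_1l (1 - beta)); apply: Rle_Rpower_l; lra.
- by left; exact: Rpower_gt0.
- by move=> d; exact: pwS_ge.
have -> : 1 - g / (g + e) = e / (g + e) by field; lra.
apply: Rle_trans N _; right.
have E x y : 0 < x -> 0 < y -> Rpower (Rpower x (/ beta) / y) (1 - beta) * x = Rpower x (/ beta) * Rpower y (beta - 1).
  move=> x0 y0; rewrite Rpower_div //; last exact: Rpower_gt0.
  have H : Rpower (Rpower x (/ beta)) (1 - beta) * x = Rpower x (/ beta).
    rewrite -{2}(Rpower_beta_inv x0) -Rpower_plus.
    have -> : 1 - beta + beta = 1 by ring.
    by rewrite Rpower_1 //; exact: Rpower_gt0.
  have -> : beta - 1 = - (1 - beta) by ring.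
  rewrite Rpower_Ropp -[in RHS]H.
  by field; have := Rpower_gt0 y (1 - beta); lra.
rewrite {2}/g {3}/e; rewrite !E; try lra.
rewrite -/g -/e -Rmult_plus_distr_r.
by rewrite -{2}[g + e]Rpower_1 -?Rpower_plus; [congr Rpower; ring|lra].
Qed.

(** * Averaging over subcubes *)

Lemma RplusA : associative Rplus.
Proof. by move=> x y z; rewrite Rplus_assoc. Qed.

HB.instance Definition _ := Monoid.isComLaw.Build R 0 Rplus RplusA Rplus_comm Rplus_0_l.

Notation "\rsum_ ( i <- r ) F" := (\big[Rplus/0]_(i <- r) F)
  (at level 36, F at level 36, i, r at level 50).
Notation "\rsum_ i F" := (\big[Rplus/0]_i F) (at level 36, F at level 36, i at level 0).

Lemma rsum_enum (T : finType) (F : T -> R) : \rsum_(i <- enum T) F i = \rsum_i F i.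
Proof. by rewrite big_enum. Qed.

Lemma rsum_add I (r : seq I) (F G : I -> R) :
  \rsum_(i <- r) (F i + G i) = \rsum_(i <- r) F i + \rsum_(i <- r) G i.
Proof. exact: big_split. Qed.

Lemma rsum_scale I (r : seq I) c (F : I -> R) :
  \rsum_(i <- r) (c * F i) = c * \rsum_(i <- r) F i.
Proof. by elim: r => [|i r IH]; rewrite !(big_nil, big_cons) ?IH; ring. Qed.

Lemma rsum_const I (r : seq I) c : \rsum_(i <- r) c = INR (size r) * c.
Proof.
elim: r => [|i r IH]; rewrite !(big_nil, big_cons); first by rewrite /=; ring.
by rewrite IH -[size (i :: r)]/((size r).+1) S_INR; ring.
Qed.

Lemma rsum_le_in (I : eqType) (r : seq I) (F G : I -> R) :
  {in r, forall i, F i <= G i} -> \rsum_(i <- r) F i <= \rsum_(i <- r) G i.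
Proof.
elim: r => [|i r IH] H; first by rewrite !big_nil; lra.
rewrite !big_cons; apply: Rplus_le_compat; first by apply: H; rewrite inE eqxx.
by apply: IH => j jr; apply: H; rewrite inE jr orbT.
Qed.

Lemma rsum_le I (r : seq I) (F G : I -> R) :
  (forall i, F i <= G i) -> \rsum_(i <- r) F i <= \rsum_(i <- r) G i.
Proof.
by move=> H; elim: r => [|i r IH]; rewrite !(big_nil, big_cons); [lra|have := H i; lra].
Qed.

Definition bR (b : bool) : R := if b then 1 else 0.

Lemma bR01 b : 0 <= bR b <= 1.
Proof. by case: b => /=; lra. Qed.

Definition chi (T : finType) (A : {set T}) (x : T) : R := bR (x \in A).

Lemma chi01 (T : finType) (A : {set T}) x : 0 <= chi A x <= 1.
Proof. exact: bR01. Qed.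

Lemma INR_count I (P : pred I) (r : seq I) : INR (count P r) = \rsum_(i <- r) bR (P i).
Proof.
elim: r => [|i r IH]; rewrite !(big_nil, big_cons) //= -IH plus_INR.
by case: (P i).
Qed.

Lemma INR_card (T : finType) (A : {set T}) : INR #|A| = \rsum_x chi A x.
Proof. by rewrite -INR_count -size_filter cardE /enum_mem unlock. Qed.

Section Cube.
Variable n : nat.
Implicit Types (x y : cube n) (f g h : cube n -> R) (i j : 'I_n) (s t : seq 'I_n).

Lemma flipE x i j : flip x i j = if j == i then ~~ x j else x j.
Proof. by rewrite ffunE. Qed.

Lemma flipK i : involutive (fun x => flip x i).
Proof. by move=> x; apply/ffunP => j; rewrite !flipE; case: eqP => //; rewrite negbK. Qed.

Lemma flipC x i j : flip (flip x i) j = flip (flip x j) i.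
Proof. by apply/ffunP => l; rewrite !flipE; case: (l == i); case: (l == j). Qed.

Definition mean f : R := (\rsum_x f x) / 2 ^ n.

Lemma pow2_gt0 m : 0 < 2 ^ m. Proof. apply: pow_lt; lra. Qed.

Lemma mean_ext f g : f =1 g -> mean f = mean g.
Proof. by move=> fg; rewrite /mean (eq_bigr g). Qed.

Lemma mean_le f g : (forall x, f x <= g x) -> mean f <= mean g.
Proof.
move=> fg; apply: Rmult_le_compat_r; last exact: rsum_le.
by left; apply: Rinv_0_lt_compat; exact: pow2_gt0.
Qed.

Lemma mean_add f g : mean (fun x => f x + g x) = mean f + mean g.
Proof. by rewrite /mean rsum_add /Rdiv Rmult_plus_distr_r. Qed.

Lemma mean_scale c f : mean (fun x => c * f x) = c * mean f.
Proof. by rewrite /mean rsum_scale /Rdiv Rmult_assoc. Qed.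

Lemma mean_sub f g : mean (fun x => f x - g x) = mean f - mean g.
Proof.
transitivity (mean (fun x => f x + (-1) * g x)); first by apply: mean_ext => x; ring.
by rewrite mean_add mean_scale; ring.
Qed.

Lemma mean_const c : mean (fun=> c) = c.
Proof.
rewrite /mean rsum_const -[index_enum _]enumT -cardE card_ffun card_bool card_ord.
have -> : INR (expn 2 n) = 2 ^ n.
  by elim: n => //= m IH; rewrite expnS mult_INR IH /=; ring.
by field; have := pow2_gt0 n; lra.
Qed.

Lemma mean_flip i f : mean (fun x => f (flip x i)) = mean f.
Proof.
rewrite /mean; congr (_ / _).
by rewrite [RHS](reindex_inj (inv_inj (flipK i))).
Qed.

Lemma muE (A : {set cube n}) : mu A = mean (chi A).
Proof. by rewrite /mu INR_card. Qed.

Lemma mean_rsum I (r : seq I) (F : I -> cube n -> R) :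
  mean (fun x => \rsum_(i <- r) F i x) = \rsum_(i <- r) mean (F i).
Proof.
elim: r => [|i r IH].
  by rewrite big_nil -[RHS](mean_const 0); apply: mean_ext => x; rewrite big_nil.
by rewrite big_cons -IH -mean_add; apply: mean_ext => x; rewrite big_cons.
Qed.

Definition av i g x : R := (g x + g (flip x i)) / 2.

(** The value at [x] is the mean of [g] over the subcube through [x] whose free coordinates are
    those in [s]. *)
Fixpoint avs s g : cube n -> R := if s is i :: s' then av i (avs s' g) else g.

Lemma avs_le s f g : (forall x, f x <= g x) -> forall x, avs s f x <= avs s g x.
Proof. by move=> fg; elim: s => [|i s IH] x //=; rewrite /av; have := IH x; have := IH (flip x i); lra. Qed.

Lemma avs_add s f g x : avs s (fun y => f y + g y) x = avs s f x + avs s g x.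
Proof. by elim: s x => [|i s IH] x //=; rewrite /av !IH; lra. Qed.

Lemma avs_scale s c f x : avs s (fun y => c * f y) x = c * avs s f x.
Proof. by elim: s x => [|i s IH] x //=; rewrite /av !IH; lra. Qed.

Lemma avs_const s c x : avs s (fun=> c) x = c.
Proof. by elim: s x => [|i s IH] x //=; rewrite /av !IH; lra. Qed.

Lemma avs_sub s f g x : avs s (fun y => f y - g y) x = avs s f x - avs s g x.
Proof. by elim: s x => [|i s IH] x //=; rewrite /av !IH; lra. Qed.

Lemma avs_flip s i f x : avs s (fun y => f (flip y i)) x = avs s f (flip x i).
Proof. by elim: s x => [|j s IH] x //=; rewrite /av !IH flipC. Qed.

Lemma avs_av s i f x : avs s (av i f) x = av i (avs s f) x.
Proof. by elim: s x => [|j s IH] x //=; rewrite /av !IH /av (flipC x i j); lra. Qed.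

Lemma mean_av i f : mean (av i f) = mean f.
Proof.
transitivity (mean (fun x => / 2 * (f x + f (flip x i)))); first by apply: mean_ext => x; rewrite /av; lra.
by rewrite mean_scale mean_add mean_flip; lra.
Qed.

Lemma mean_avs s f : mean (avs s f) = mean f.
Proof. by elim: s => [|i s IH] //=; rewrite mean_av IH. Qed.

Lemma avs_inv s i f x : i \in s -> avs s f (flip x i) = avs s f x.
Proof.
elim: s x => // j s IH x; rewrite inE => /orP[/eqP->|si] /=; rewrite /av.
  by rewrite flipK; lra.
by rewrite IH // flipC IH.
Qed.

Lemma flip_invariant_eq s (F : cube n -> R) : (forall i x, i \in s -> F (flip x i) = F x) ->
  forall x y, (forall j, j \notin s -> x j = y j) -> F x = F y.
Proof.
elim: s => [|i s IH] Finv x y xy.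
  by congr F; apply/ffunP => j; exact: xy.
have {}IH := IH (fun j z js => Finv j z ltac:(by rewrite inE js orbT)).
have [xyi|xyi] := boolP (x i == y i).
  by apply: IH => j js; have [->|ji] := eqVneq j i; [exact/eqP|apply: xy; rewrite inE negb_or ji].
rewrite -(Finv i) ?inE ?eqxx //; apply: IH => j js; rewrite flipE.
have [->|ji] := eqVneq j i; last by apply: xy; rewrite inE negb_or ji.
by move: xyi; case: (x i); case: (y i).
Qed.

Lemma avs_full s f x : (forall i, i \in s) -> avs s f x = mean f.
Proof.
move=> all_s; rewrite -(mean_avs s f) -[LHS]mean_const; apply: mean_ext => y.
by apply: (@flip_invariant_eq s) => [i z|j]; [exact: avs_inv|rewrite all_s].
Qed.

(** * The isoperimetric inequality in every subcube *)

Section Isoperimetry.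
Variable U : {set cube n}.

(** For [x] in [U] this is the boundary degree h_U inside the subcube with free coordinates [t];
    [isoperimetry] discards the other points through the factor [chi U]. *)
Definition out t x : nat := count (fun i => flip x i \notin U) t.
Arguments out : simpl never.

Lemma out_cons i t x : out (i :: t) x = ((flip x i \notin U) + out t x)%N.
Proof. by []. Qed.

(** Induction step, with [x] on the side of the denser half. Keeping [z = flip x i] as a hypothesis
    lets the two halves exchange roles. *)
Lemma iso_split i t x z : z = flip x i ->
  (forall y, avs t (fun y => chi U y * pw (out t y)) y >=
    2 * avs t (chi U) y * (1 - avs t (chi U) y)) ->
  avs t (chi U) z <= avs t (chi U) x ->
  let a := (avs t (chi U) x + avs t (chi U) z) / 2 in
  2 * a * (1 - a) <= (avs t (fun y => chi U y * pw (out (i :: t) y)) x +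
    avs t (fun y => chi U y * pw (out (i :: t) y)) z) / 2.
Proof.
move=> zE IH a10.
have I0 := IH x; have I1 := IH z.
have a1_ge0 : 0 <= avs t (chi U) z.
  by rewrite -(avs_const t 0 z); apply: avs_le => y; have /= := chi01 U y; lra.
have a0_le1 : avs t (chi U) x <= 1.
  by rewrite -(avs_const t 1 x); apply: avs_le => y; have /= := chi01 U y; lra.
have [al [ga [al01 ga0 step ineq]]] := two_point (conj a1_ge0 a10) a0_le1.
(* Pointwise: a [y] in [U] whose neighbour across is outside gains one edge, which [step] pays for;
   in the other cases the [ga] term is at most 0. *)
have Hx : al * avs t (fun y => chi U y * pw (out t y)) x + ga * (avs t (chi U) x - avs t (chi U) z)
    <= avs t (fun y => chi U y * pw (out (i :: t) y)) x.
  rewrite zE -avs_flip -avs_sub -!avs_scale -avs_add; apply: avs_le => y.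
  have p0 := pw_ge0 (out t y); have p1 := step (out t y).
  rewrite out_cons /chi; case: (y \in U); case: (flip y i \in U); rewrite ?add0n ?add1n /bR; nra.
have Hz : avs t (fun y => chi U y * pw (out t y)) z <= avs t (fun y => chi U y * pw (out (i :: t) y)) z.
  apply: avs_le => y; apply: Rmult_le_compat_l; first by have /= := chi01 U y; lra.
  by apply: pw_homo; exact: leq_addl.
(* The two halves combine exactly: [2a(1-a)] is the average of [2*a0*(1-a0)] and [2*a1*(1-a1)] plus
   [(a0-a1)^2 / 2]. *)
have := Rmult_le_compat_l al _ _ (proj1 al01) (Rge_le _ _ I0); rewrite /=. lra.
Qed.

Lemma isoperimetry t x : avs t (fun y => chi U y * pw (out t y)) x >=
  2 * avs t (chi U) x * (1 - avs t (chi U) x).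
Proof.
elim: t x => [|i t IH] x; first by rewrite /= /chi; case: (x \in U) => /=; lra.
rewrite [avs _ _ _]/= [avs (i :: t) (chi U)]/= /av.
have [le|lt] := Rle_lt_dec (avs t (chi U) (flip x i)) (avs t (chi U) x).
  by have /= := iso_split (erefl (flip x i)) IH le; lra.
by have /= := iso_split (esym (flipK i x)) IH (Rlt_le _ _ lt); rewrite Rplus_comm [avs t _ (flip _ _) + _]Rplus_comm; lra.
Qed.

End Isoperimetry.

(** * Squared L2 norms and noise stability *)

Definition nrm f : R := mean (fun x => f x ^ 2).

Lemma nrm_ext f g : f =1 g -> nrm f = nrm g.
Proof. by move=> fg; apply: mean_ext => x; rewrite fg. Qed.

Lemma nrm_ge0 f : 0 <= nrm f.
Proof. by rewrite -(mean_const 0); apply: mean_le => x; exact: pow2_ge_0. Qed.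

Lemma nrm_pythagoras i f : nrm f = nrm (av i f) + nrm (fun x => f x - av i f x).
Proof.
rewrite /nrm -(mean_av i (fun x => f x ^ 2)) -mean_add; apply: mean_ext => x.
by rewrite /av /=; lra.
Qed.

Lemma nrm_avs_le s f : nrm (avs s f) <= nrm f.
Proof.
elim: s => [|i s IH] /=; first lra.
have := nrm_pythagoras i (avs s f); have := nrm_ge0 (fun x => avs s f x - av i (avs s f) x); lra.
Qed.

(** Expectation of [Phi] over a random subsequence of [s] that keeps each entry independently with
    probability 1/2. *)
Fixpoint subavg s (Phi : seq 'I_n -> R) : R :=
  if s is i :: s' then (subavg s' Phi + subavg s' (fun t => Phi (i :: t))) / 2 else Phi [::].

Lemma subavg_le s Phi Psi : (forall t, subseq t s -> Phi t <= Psi t) -> subavg s Phi <= subavg s Psi.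
Proof.
elim: s Phi Psi => [|i s IH] Phi Psi H /=; first exact: H.
have := IH Phi Psi (fun t ts => H t (subseq_trans ts (subseq_cons s i))).
have := IH (fun t => Phi (i :: t)) (fun t => Psi (i :: t)) (fun t ts => H (i :: t) ltac:(by rewrite /= eqxx)).
lra.
Qed.

Lemma subavg_ext s Phi Psi : Phi =1 Psi -> subavg s Phi = subavg s Psi.
Proof. by move=> H; apply: Rle_antisym; apply: subavg_le => t _; rewrite H; lra. Qed.

Lemma subavg_add s Phi Psi : subavg s (fun t => Phi t + Psi t) = subavg s Phi + subavg s Psi.
Proof. by elim: s Phi Psi => [|i s IH] Phi Psi //=; rewrite !IH; lra. Qed.

Lemma subavg_scale s c Phi : subavg s (fun t => c * Phi t) = c * subavg s Phi.
Proof. by elim: s Phi => [|i s IH] Phi //=; rewrite !IH; lra. Qed.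

Lemma subavg_const s c : subavg s (fun=> c) = c.
Proof. by elim: s => [|i s IH] //=; rewrite !IH; lra. Qed.

Lemma mean_subavg s (F : seq 'I_n -> cube n -> R) :
  mean (fun x => subavg s (fun t => F t x)) = subavg s (fun t => mean (F t)).
Proof.
elim: s F => [|i s IH] F //=; rewrite -!IH -mean_add /Rdiv Rmult_comm -mean_scale.
by apply: mean_ext => x /=; lra.
Qed.

(** [avs t] kills exactly the characters whose support meets [t], so for duplicate-free [s] the
    Fourier weight on a set S is multiplied by 2^(-|S ∩ s|). *)
Definition stab s f : R := subavg s (fun t => nrm (avs t f)).

(** The part of [f] even in coordinate [i] is unaffected by averaging over [i]; the odd part
    survives only when [i] is not chosen. *)
Lemma stab_cons i s f : stab (i :: s) f = stab s (av i f) + stab s (fun x => f x - av i f x) / 2.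
Proof.
rewrite /stab /=.
rewrite (_ : subavg s (fun t => nrm (avs t f)) =
  subavg s (fun t => nrm (avs t (av i f))) + subavg s (fun t => nrm (avs t (fun x => f x - av i f x)))).
  rewrite (_ : subavg s (fun t => nrm (av i (avs t f))) = subavg s (fun t => nrm (avs t (av i f)))); first lra.
  by apply: subavg_ext => t; apply: nrm_ext => x; rewrite avs_av.
rewrite -subavg_add; apply: subavg_ext => t; rewrite (nrm_pythagoras i); congr (_ + _); apply: nrm_ext => x.
  by rewrite avs_av.
by rewrite avs_sub avs_av.
Qed.

(** Weight at level zero relative to [s] counts fully, all other weight at most 1/2. *)
Lemma stab_le s f : stab s f <= nrm (avs s f) / 2 + nrm f / 2.
Proof.
elim: s f => [|i s IH] f; first by rewrite /stab /=; lra.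
rewrite stab_cons; set h := fun x => _.
have sh : stab s h <= nrm h.
  by rewrite -(subavg_const s (nrm h)); apply: subavg_le => t _; exact: nrm_avs_le.
have := IH (av i f); rewrite (nrm_ext (avs_av s i f)) => H.
by have := nrm_pythagoras i f; rewrite -/h /=; lra.
Qed.

Lemma nrm_avs_split i s f : nrm (avs s f) = nrm (avs (i :: s) f) + nrm (avs s (fun x => f x - av i f x)).
Proof.
rewrite (nrm_pythagoras i); congr (_ + _); apply: nrm_ext => x.
by rewrite avs_sub avs_av.
Qed.

(* At noise rate 1/2, level-one Fourier weight counts 1/2 and higher levels at most 1/4. *)
Lemma stab_le_level1 s f : uniq s -> stab s f <= 3 / 4 * nrm (avs s f)
  + / 4 * \rsum_(j <- s) (nrm (avs (rem j s) f) - nrm (avs s f)) + / 4 * nrm f.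
Proof.
elim: s f => [|i s IH] f us; first by rewrite /stab big_nil /=; lra.
move: us => /= /andP[is_ us]; rewrite stab_cons; set h := fun x => _.
(* The part odd in [i] already has level one and is halved by [stab_cons], so the cruder bound
   suffices there; the even part is left to induction. *)
have L0 := stab_le s h; have L1 := IH (av i f) us.
rewrite big_cons eqxx.
rewrite (_ : \rsum_(j <- s) _ = \rsum_(j <- s)
   (nrm (avs (rem j s) (av i f)) - nrm (avs s (av i f)))); last first.
  rewrite big_seq_cond [RHS]big_seq_cond; apply: eq_bigr => j; rewrite andbT => js.
  have -> : (i == j) = false by apply/eqP => ij; move: is_; rewrite ij js.
  by rewrite /= -(nrm_ext (avs_av (rem j s) i f)) -(nrm_ext (avs_av s i f)).
have := nrm_avs_split i s f; have := nrm_pythagoras i f; rewrite -/h /=.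
rewrite -(nrm_ext (avs_av s i f)); lra.
Qed.

End Cube.

Arguments out : simpl never.

(** * Half-cubes and level-one coefficients *)

Section HalfCubes.
Variable n : nat.
Implicit Types (x y : cube n) (f g : cube n -> R) (i j : 'I_n) (s t : seq 'I_n).

(** Normalised by the whole cube: half the mean of [f] over the half-cube. *)
Definition half_mean f i b : R := mean (fun x => f x * bR (x i == b)).

Lemma half_mean_sum f i : mean f = half_mean f i true + half_mean f i false.
Proof. by rewrite -mean_add; apply: mean_ext => x; case: (x i) => /=; ring. Qed.

Lemma avs_coord s i b f x : i \notin s ->
  avs s (fun y => f y * bR (y i == b)) x = avs s f x * bR (x i == b).
Proof.
elim: s x => //= j s IH x; rewrite inE negb_or => /andP[/negbTE ij si].
by rewrite /av !IH // flipE ij; lra.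
Qed.

Lemma avs_rem_enum i f x : avs (rem i (enum 'I_n)) f x = 2 * half_mean f i (x i).
Proof.
have all_s j : j \in i :: rem i (enum 'I_n).
  by rewrite -(perm_mem (perm_to_rem (mem_enum 'I_n i))) mem_enum.
rewrite /half_mean -(avs_full _ x all_s) /= /av !avs_coord ?mem_rem_uniqF ?enum_uniq //.
by rewrite flipE !eqxx; case: (x i) => /=; lra.
Qed.

(** Averaging over all coordinates but [i] leaves only the constant and the level-one character of
    [i], whose coefficient is, up to sign, the difference on the right. *)
Lemma nrm_avs_rem_enum i f :
  nrm (avs (rem i (enum 'I_n)) f) - mean f ^ 2 = (half_mean f i true - half_mean f i false) ^ 2.
Proof.
rewrite /nrm -(mean_av i) (half_mean_sum f i).
rewrite (@mean_ext _ _ (fun=> 2 * (half_mean f i true ^ 2 + half_mean f i false ^ 2))).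
  by rewrite mean_const; ring.
by move=> x; rewrite /av !avs_rem_enum flipE eqxx; case: (x i) => /=; field.
Qed.

Lemma half_mean_dist (U : {set cube n}) i :
  Rabs (half_mean (chi U) i true - half_mean (chi U) i false)
    <= mean (fun x => chi U x * bR (flip x i \notin U)).
Proof.
set M := mean _.
have bound (c : R) : Rabs c = 1 ->
    c * (half_mean (chi U) i true - half_mean (chi U) i false) <= M.
  move=> c1; set S := c * _; have SE : S = mean (fun x => c * (chi U x * bR (x i == true) - chi U x * bR (x i == false))).
    by rewrite mean_scale mean_sub.
  suff : 2 * S <= 2 * M by lra.
  have {1}-> : 2 * S = S + S by ring.
  have -> : 2 * M = M + M by ring.
  (* Pair each [x] with [flip x i]: a pair contributes to the difference only if exactly one
     endpoint lies in [U]. *)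
  rewrite SE /M -[X in _ + X <= _](mean_flip i) -[X in _ <= _ + X](mean_flip i) -!mean_add; apply: mean_le => x.
  rewrite flipK flipE eqxx /chi.
  by move: c1; rewrite /Rabs; case: Rcase_abs => ? c1; case: (x \in U); case: (flip x i \in U); case: (x i) => /=; lra.
have := bound 1 (Rabs_R1); have := bound (-1).
rewrite Rabs_Ropp Rabs_R1 => /(_ erefl) H1 H2.
by apply: Rabs_le; lra.
Qed.

Lemma mean_subcube s (z : cube n) : uniq s ->
  mean (fun x => bR (all (fun i => x i == z i) s)) = (/ 2) ^ size s.
Proof.
elim: s => [|i s IH] /=; first by rewrite mean_const.
move=> /andP[is_ us]; rewrite -IH // -(mean_av i) -mean_scale; apply: mean_ext => x.
have E : all (fun j => flip x i j == z j) s = all (fun j => x j == z j) s.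
  apply: eq_in_all => j js; rewrite flipE.
  by have [ji|//] := eqVneq j i; case/negP: is_; rewrite -ji.
rewrite /av E flipE eqxx; case: (all _ s); rewrite ?andbT ?andbF /=; last lra.
by case: (x i); case: (z i) => /=; lra.
Qed.

Lemma subavg_out (U : {set cube n}) s x :
  subavg s (fun t => INR (out U t x)) = INR (out U s x) / 2.
Proof.
elim: s => [|i s IH]; first by rewrite /out /=; lra.
rewrite /= IH (@subavg_ext _ _ _ (fun t => INR (flip x i \notin U) + INR (out U t x))); last first.
  by move=> t /=; rewrite out_cons plus_INR.
rewrite subavg_add subavg_const IH out_cons plus_INR; lra.
Qed.

Lemma subavg_out0 (U : {set cube n}) s x :
  subavg s (fun t => bR (out U t x == 0%N)) = (/ 2) ^ out U s x.
Proof.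
elim: s => [|i s IH]; first by rewrite /out /=.
rewrite /= IH (@subavg_ext _ _ _ (fun t => bR (flip x i \in U) * bR (out U t x == 0%N))); last first.
  by move=> t /=; rewrite out_cons; case: (flip x i \in U) => /=; rewrite ?add0n ?add1n /=; ring.
rewrite subavg_scale IH out_cons; case: (flip x i \in U) => /=; rewrite ?add0n ?add1n /=; lra.
Qed.

Lemma subavg_pw1 (U : {set cube n}) s x :
  subavg s (fun t => pw (out U t x)) <= INR (out U s x) / 2.
Proof. by rewrite -subavg_out; apply: subavg_le => t _; exact: pw_le_id. Qed.

(** With [d] outgoing directions, [pw_le_half] averages to [d/4 + 1/2 - 2^(-d)/2]. The stated line
    meets this value at [d = 1] and [d = 2] and lies above it elsewhere. *)
Lemma subavg_pw2 (U : {set cube n}) s x :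
  subavg s (fun t => pw (out U t x)) <= 1 / 8 + 3 / 8 * INR (out U s x).
Proof.
apply: (@Rle_trans _ (subavg s (fun t => / 2 * INR (out U t x) +
    (/ 2 + (- / 2) * bR (out U t x == 0%N))))).
  apply: subavg_le => t _; have := pw_le_half (out U t x).
  by case: (out U t x) => [|d] /=; lra.
rewrite !subavg_add !subavg_scale subavg_const subavg_out subavg_out0.
case: (out U s x) => [|[|[|d]]]; [by rewrite /=; lra..|].
have := pow_lt (/ 2) d.+3 ltac:(lra); have := pos_INR d; rewrite !S_INR; lra.
Qed.

End HalfCubes.

(** * Numerical extraction of the large directions *)

Section Directions.
Variables (n k : nat) (eps c w : R) (p d : 'I_n -> R).
Hypotheses (k12 : k = 1%N \/ k = 2%N) (cE : c = / 2 ^ k).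
Hypotheses (eps0 : 0 < eps <= / 2000) (w0 : 0 <= w <= eps) (nw2 : INR n * w ^ 2 <= eps).
Hypotheses (p0 : forall i, 0 <= p i <= c + eps)
  (psum : \rsum_i p i <= INR k * c * (1 + eps)).
Hypotheses (dp : forall i, Rabs (d i) <= p i + w)
  (pd : forall i, c * p i <= d i ^ 2 + 11 * c * eps)
  (dsum : INR k * c ^ 2 - 9 * eps <= \rsum_i (d i ^ 2)).

Lemma c_bounds : / 4 <= c <= / 2.
Proof. by rewrite cE; case: k12 => -> /=; lra. Qed.

Lemma d_sqr_le i : d i ^ 2 <= (p i + w) ^ 2.
Proof.
rewrite -(pow2_abs (d i)); apply: pow_incr; split; [exact: Rabs_pos|exact: dp].
Qed.

(** Combining [pd] with [d_sqr_le] gives [p (c - p) <= 23 c eps]; whichever factor is at least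
    [c / 2], the other is at most [46 eps]. *)
Lemma dichotomy i : p i <= 46 * eps \/ c - 46 * eps <= p i.
Proof.
have cb := c_bounds; have [p0i p1i] := p0 i; have h := d_sqr_le i; have h2 := pd i.
have q : p i * (c - p i) <= 23 * c * eps by nra.
by have [small|big] := Rle_lt_dec (p i) (c / 2); [left|right]; nra.
Qed.

Lemma large_directions :
  exists J : {set 'I_n}, #|J| = k /\ forall i, i \in J -> c - 46 * eps <= p i.
Proof.
have cb := c_bounds.
pose J0 := [set i | is_left (Rlt_dec (c / 2) (p i))].
have J0P i : i \in J0 -> c - 46 * eps <= p i.
  by rewrite inE; case: Rlt_dec => //= pi _; case: (dichotomy i); lra.
have J0N i : i \notin J0 -> p i <= 46 * eps.
  by rewrite inE; case: Rlt_dec => //= pi _; case: (dichotomy i) => //; lra.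
have kJ0 : (k <= #|J0|)%N.
  rewrite leqNgt; apply/negP => J0k.
  have J1 : INR #|J0| <= INR k - 1.
    by have := le_INR _ _ (leP J0k); rewrite S_INR; lra.
  (* A small direction has [d^2 <= 2 p^2 + 2 w^2] with [p <= 46 eps], a large one
     [d^2 <= (c + 2 eps)^2]. With fewer than [k] large ones, [dsum] would force [c^2] below about
     [107 eps], whereas [c^2 >= 1/16] and [eps <= 1/2000]. *)
  have : \rsum_i (d i ^ 2) <= \rsum_i ((c ^ 2 + 4 * eps) * chi J0 i + (92 * eps * p i + 2 * w ^ 2)).
    apply: rsum_le => i; have h := d_sqr_le i; have [p0i p1i] := p0 i.
    rewrite /chi; have [iJ|/J0N pi] := boolP (i \in J0) => /=; nra.
  have sz : size (index_enum 'I_n) = n by rewrite -[index_enum _]enumT size_enum_ord.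
  rewrite !rsum_add !rsum_scale -INR_card rsum_const sz => H.
  have kc : 0 <= INR k * c <= 1 by rewrite cE; case: k12 => -> /=; lra.
  have k2 : 1 <= INR k <= 2 by case: k12 => -> /=; lra.
  have J2 := pos_INR #|J0|.
  have a1 : (c ^ 2 + 4 * eps) * INR #|J0| <= (c ^ 2 + 4 * eps) * (INR k - 1).
    by apply: Rmult_le_compat_l => //; nra.
  have a2 : 92 * eps * \rsum_i p i <= 92 * eps * (1 + eps).
    apply: Rmult_le_compat_l; first lra.
    by apply: Rle_trans psum _; nra.
  have c2 : / 16 <= c ^ 2 by nra.
  have ek : eps * (INR k - 1) <= eps by nra.
  have ee : eps * eps <= eps / 2000 by nra.
  nra.
exists [set i in take k (enum J0)]; split.
  rewrite cardsE (card_uniqP _) ?take_uniq ?enum_uniq // size_takel //.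
  by rewrite -cardE.
by move=> i; rewrite inE => /mem_take; rewrite mem_enum; exact: J0P.
Qed.

End Directions.

(** * Edges between the parts *)

Section Partition.
Variables (n : nat) (A B W : {set cube n}).
Hypotheses (AB : [disjoint A & B]) (AW : [disjoint A & W]) (BW : [disjoint B & W])
  (ABW : A :|: B :|: W = setT).

(** Membership in [B] is phrased through [~: B] so that the sum over [i] matches [out (~: B)]. *)
Definition edge_measure (i : 'I_n) : R := mean (fun x => chi A x * bR (flip x i \notin ~: B)).

Lemma chi_split x : chi (~: B) x = chi A x + chi W x.
Proof.
have := in_setT x; rewrite -ABW !inE /chi inE.
move: (disjointFr AB (x := x)) (disjointFr AW (x := x)) (disjointFr BW (x := x)).
case: (x \in A) => [/(_ erefl) -> /(_ erefl) -> _|_ _] /=; first by lra.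
by case: (x \in B) => [/(_ erefl) ->|_ /= ->] /=; lra.
Qed.

Lemma edge_measure_bounds i : 0 <= edge_measure i <= mu A.
Proof.
rewrite muE -{1}(mean_const n 0); split; apply: mean_le => x;
  by have := chi01 A x; have := bR01 (flip x i \notin ~: B); nra.
Qed.

Lemma edge_measure_sum :
  mean (fun x => chi A x * INR (out (~: B) (enum 'I_n) x)) = \rsum_i edge_measure i.
Proof.
rewrite -mean_rsum; apply: mean_ext => x.
by rewrite rsum_scale INR_count rsum_enum.
Qed.

Lemma edge_measure_sum_le : \rsum_i edge_measure i <= INR #|edge_boundary A B| / 2 ^ n.
Proof.
rewrite -edge_measure_sum /mean; apply: Rmult_le_compat_r.
  by left; apply: Rinv_0_lt_compat; exact: pow2_gt0.
(* An edge is coded by its endpoint in [A] and its direction. *)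
pose P := [set q : cube n * 'I_n | (q.1 \in A) && (flip q.1 q.2 \in B)].
pose phi (q : cube n * 'I_n) := (q.1, flip q.1 q.2).
have flip_inj (x : cube n) : injective (flip x).
  by move=> i j /ffunP /(_ i); rewrite !flipE eqxx; case: eqP => // _; case: (x i).
have phi_inj : injective phi by move=> [x i] [y j] [-> /flip_inj ->].
have PE : phi @: P \subset edge_boundary A B.
  apply/subsetP => _ /imsetP[[x i] /[!inE] /= /andP[xA xB] ->]; rewrite /= xA xB /= /adj.
  rewrite (_ : [set j | _] = [set i]) ?cards1 //; apply/setP => j; rewrite !inE flipE.
  by case: (j == i); rewrite ?eqxx //; case: (x j).
apply: (@Rle_trans _ (INR #|P|)); last first.
  by apply/le_INR/leP; rewrite -(card_imset _ phi_inj); exact: subset_leq_card.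
rewrite INR_card.
rewrite (eq_bigr (fun x => \rsum_i chi P (x, i))); last first.
  move=> x _; rewrite INR_count rsum_enum -rsum_scale; apply: eq_bigr => i _.
  by rewrite /chi !inE negbK /=; case: (x \in A); case: (flip x i \in B) => /=; ring.
rewrite pair_bigA /=; right; apply: eq_bigr; case=> x i _ //.
Qed.

Lemma dir_boundary_ge i : edge_measure i * 2 ^ n <= INR #|dir_boundary A i|.
Proof.
have p2 := pow2_gt0 n; rewrite /edge_measure /mean /Rdiv Rmult_assoc Rinv_l; last lra.
rewrite Rmult_1_r.
pose Q := [set x in A | flip x i \notin A].
pose phi x := (x, flip x i).
have phi_inj : injective phi by move=> x y [].
apply: (@Rle_trans _ (INR #|Q|)); last first.
  apply/le_INR/leP; rewrite -(card_imset _ phi_inj); apply/subset_leq_card/subsetP.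
  by move=> _ /imsetP[x /[!inE] /andP[xA xB] ->]; rewrite /= xA xB eqxx.
rewrite INR_card; apply: rsum_le => x; rewrite /chi !inE negbK.
case: (x \in A) => /=; last lra.
have [fB|] := boolP (flip x i \in B); last by case: (flip x i \in A) => /=; lra.
by rewrite (disjointFl AB fB) /=; lra.
Qed.

Variable eps : R.
Hypotheses (n2 : (2 <= n)%N) (muW : mu W <= eps * Rpower (INR n) (- beta)).

Lemma INRn_ge2 : 2 <= INR n.
Proof. by have := le_INR _ _ (leP n2); rewrite /=; lra. Qed.

Lemma muW_ge0 : 0 <= mu W.
Proof. by rewrite muE -(mean_const n 0); apply: mean_le => x; have := chi01 W x; lra. Qed.

Lemma muW_pw : mu W * pw n <= eps.
Proof.
have n_gt0 := INRn_ge2; have -> : pw n = Rpower (INR n) beta by case: n n2.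
have P := Rpower_gt0 (INR n) beta.
have := Rmult_le_compat_r _ _ _ (Rlt_le _ _ P) muW.
by rewrite Rmult_assoc -Rpower_plus Rplus_opp_l Rpower_O; lra.
Qed.

Lemma muW_le : mu W <= eps.
Proof.
have := muW_pw; have := muW_ge0; have : 1 <= pw n by case: n n2 => // m _; exact: pwS_ge1.
nra.
Qed.

Lemma muW_sqr : eps <= 1 -> INR n * mu W ^ 2 <= eps.
Proof.
move=> e1; have w0 := muW_ge0; have wp := muW_pw; have n_ge2 := INRn_ge2.
have h : INR n <= pw n ^ 2.
  have -> : pw n = Rpower (INR n) beta by case: n n2.
  rewrite -Rpower_pow; last exact: Rpower_gt0.
  rewrite Rpower_mult -{1}(Rpower_1 (INR n)); last lra.
  by apply: Rle_Rpower; [lra|have := beta_ge_half; rewrite /=; lra].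
have : mu W ^ 2 * INR n <= mu W ^ 2 * pw n ^ 2.
  by apply: Rmult_le_compat_l => //; exact: pow2_ge_0.
have : 0 <= mu W * pw n by apply: Rmult_le_pos => //; exact: pw_ge0.
have -> : mu W ^ 2 * pw n ^ 2 = (mu W * pw n) * (mu W * pw n) by ring.
nra.
Qed.

(** [isoperimetry] integrated over the cube. Points of [W] have at most [n] outgoing directions, so
    they cost at most [mu W * pw n <= eps]. *)
Lemma isoperimetry_mean t : subseq t (enum 'I_n) ->
  2 * mean (chi (~: B)) - 2 * nrm (avs t (chi (~: B))) <=
  mean (fun x => chi A x * pw (out (~: B) t x)) + eps.
Proof.
move=> ts; set U := ~: B; apply: (@Rle_trans _ (mean (fun x => chi U x * pw (out U t x)))).
  rewrite -(mean_avs t (fun x => chi U x * _)) -{1}(mean_avs t) /nrm -!mean_scale -mean_sub.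
  by apply: mean_le => x; have := isoperimetry U t x; rewrite /=; lra.
have H : mean (fun x => pw n * chi W x) <= eps by rewrite mean_scale -muE; have := muW_pw; lra.
apply: Rle_trans (Rplus_le_compat_l _ _ _ H); rewrite -mean_add; apply: mean_le => x.
rewrite /U chi_split Rmult_plus_distr_r (Rmult_comm (pw n)); apply: Rplus_le_compat_l.
apply: Rmult_le_compat_l; first by have := chi01 W x; lra.
apply: pw_homo; apply: leq_trans (count_size _ _) _.
by rewrite -[X in (_ <= X)%N]size_enum_ord; exact: size_subseq.
Qed.

Definition half_diff i : R := half_mean (chi (~: B)) i true - half_mean (chi (~: B)) i false.

Lemma half_diff_le i : Rabs (half_diff i) <= edge_measure i + mu W.
Proof.
apply: Rle_trans (half_mean_dist _ _) _; rewrite muE -mean_add; apply: mean_le => x.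
rewrite chi_split; have := chi01 W x; have := bR01 (flip x i \notin ~: B); nra.
Qed.

(** Take all coordinates but [i] free: the subcubes are the two half-cubes, and edges in direction
    [i] drop out of the count. [l + nu * d] is a linear majorant of [pw], chosen later according to
    [k]. *)
Lemma single_direction (l nu : R) i :
  (forall d, pw d <= l + nu * INR d) ->
  2 * mean (chi (~: B)) * (1 - mean (chi (~: B))) - 2 * half_diff i ^ 2 <=
  l * mu A + nu * (\rsum_j edge_measure j - edge_measure i) + eps.
Proof.
move=> pwle; set u := mean _.
have := isoperimetry_mean (rem_subseq i _).
have := nrm_avs_rem_enum i (chi (~: B)); rewrite -/(half_diff i) -/u.
set N := nrm _ => NE iso.
have {}iso : 2 * u - 2 * N <= _ := iso.
apply: (@Rle_trans _ _ _ _ (Rle_trans _ _ _ iso _)); first by nra.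
apply: Rplus_le_compat_r.
rewrite -edge_measure_sum muE /edge_measure -mean_sub -!mean_scale -mean_add.
apply: mean_le => x.
have -> : INR (out (~: B) (enum 'I_n) x) =
    INR (out (~: B) (rem i (enum 'I_n)) x) + bR (flip x i \notin ~: B).
  have -> : out (~: B) (enum 'I_n) x = out (~: B) (i :: rem i (enum 'I_n)) x.
    exact/permP/perm_to_rem/mem_enum.
  by rewrite out_cons plus_INR; case: (flip x i \notin ~: B) => /=; lra.
have := pwle (out (~: B) (rem i (enum 'I_n)) x); have := chi01 A x; nra.
Qed.

(** Average [isoperimetry_mean] over a random set of free coordinates; the squared norms become
    [stab], bounded by [stab_le_level1]. *)
Lemma level1_bound (l nu : R) :
  (forall x, subavg (enum 'I_n) (fun t => pw (out (~: B) t x)) <=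
     l + nu * INR (out (~: B) (enum 'I_n) x)) ->
  3 / 2 * mean (chi (~: B)) * (1 - mean (chi (~: B))) - / 2 * \rsum_i (half_diff i ^ 2) <=
  l * mu A + nu * \rsum_i edge_measure i + eps.
Proof.
move=> pwle; set u := mean _.
have full x : avs (enum 'I_n) (chi (~: B)) x = u by apply: avs_full => i; rewrite mem_enum.
have := stab_le_level1 (chi (~: B)) (enum_uniq 'I_n).
have -> : nrm (avs (enum 'I_n) (chi (~: B))) = u ^ 2.
  by rewrite (nrm_ext full) /nrm mean_const.
have -> : nrm (chi (~: B)) = u.
  by apply: mean_ext => x; rewrite /chi; case: (_ \in _) => /=; ring.
rewrite rsum_enum (eq_bigr (fun i => half_diff i ^ 2)); last first.
  by move=> i _; rewrite -nrm_avs_rem_enum.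
move=> st0; have {st0}st : stab (enum 'I_n) (chi (~: B)) <=
  3 / 4 * u ^ 2 + / 4 * \rsum_i (half_diff i ^ 2) + / 4 * u := st0.
have : subavg (enum 'I_n) (fun t => 2 * u + (-2) * nrm (avs t (chi (~: B)))) <=
   subavg (enum 'I_n) (fun t => mean (fun x => chi A x * pw (out (~: B) t x)) + eps).
  by apply: subavg_le => t ts; have := isoperimetry_mean ts; rewrite -/u; lra.
clearbody u; rewrite !subavg_add !subavg_scale !subavg_const -mean_subavg -/(stab _ _).
have : mean (fun x => subavg (enum 'I_n) (fun t => chi A x * pw (out (~: B) t x))) <=
    l * mu A + nu * \rsum_i edge_measure i.
  rewrite -edge_measure_sum muE -!mean_scale -mean_add; apply: mean_le => x.
  rewrite subavg_scale; have := Rmult_le_compat_l _ _ _ (proj1 (chi01 A x)) (pwle x); lra.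
lra.
Qed.

End Partition.

Lemma card_subset_ord n k : (k <= n)%N -> exists J : {set 'I_n}, #|J| = k.
Proof.
move=> kn; exists [set i in take k (enum 'I_n)].
by rewrite cardsE (card_uniqP _) ?take_uniq ?enum_uniq // size_takel // size_enum_ord.
Qed.

Lemma mu_le1 n (S : {set cube n}) : mu S <= 1.
Proof. by rewrite muE -(mean_const n 1); apply: mean_le => x; have := chi01 S x; lra. Qed.

(** * Stability *)

Lemma mu_subcube n (J : {set 'I_n}) (z : cube n) :
  mu [set x : cube n | [forall i in J, x i == z i]] = / 2 ^ #|J|.
Proof.
rewrite muE -pow_inv cardE -(mean_subcube z (enum_uniq J)); apply: mean_ext => x.
rewrite /chi inE; congr bR; apply/forall_inP/allP => H i iJ; apply: H; by rewrite mem_enum in iJ *.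
Qed.

(** The left side equals [mu C - mu A + 2 mu(A \ C)], and a point of [A] outside [C] violates at
    least one coordinate of [J]. *)
Lemma symdiff_subcube_le n (A : {set cube n}) (J : {set 'I_n}) (z : cube n) :
  mu (symdiff [set x : cube n | [forall i in J, x i == z i]] A) <=
  / 2 ^ #|J| - mu A + 2 * \rsum_(i <- enum J) half_mean (chi A) i (~~ z i).
Proof.
set C := [set x | _]; rewrite -(mu_subcube J z) !muE -/C -mean_rsum -mean_scale -mean_sub -mean_add.
apply: mean_le => x; rewrite rsum_scale -INR_count.
set N := count _ _; have N0 := pos_INR N.
have N1 : x \notin C -> 1 <= INR N.
  rewrite inE negb_forall_in => /exists_inP[i iJ xz].
  have : (0 < N)%N.
    by rewrite -has_count; apply/hasP; exists i; rewrite ?mem_enum //; case: (x i) xz; case: (z i).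
  by move=> /leP /le_INR.
move: N1; rewrite /chi /symdiff in_setU !in_setD.
case: (x \in C); case: (x \in A) => /= N1; try lra.
by have := N1 erefl; lra.
Qed.

Section SmallEps.
Variables (k n : nat) (eps : R) (A B W : {set cube n}).
Hypotheses (k12 : k = 1%N \/ k = 2%N) (n2 : (2 <= n)%N) (eps0 : 0 < eps <= / 2000).
Hypotheses (AB : [disjoint A & B]) (AW : [disjoint A & W]) (BW : [disjoint B & W])
  (ABW : A :|: B :|: W = setT).
Hypotheses (muA_ge : (1 - eps) * / 2 ^ k <= mu A) (muA_le : mu A <= (1 + eps) * / 2 ^ k)
  (muW : mu W <= eps * Rpower (INR n) (- beta))
  (edges : INR #|edge_boundary A B| < (1 + eps) * INR k * 2 ^ (n - k)).

Let c := / 2 ^ k.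
Let u := mean (chi (~: B)).
Let p := edge_measure A B.
Let d := half_diff B.

Lemma k_cases : (INR k = 1 /\ c = / 2) \/ (INR k = 2 /\ c = / 4).
Proof. by rewrite /c; case: k12 => -> /=; [left|right]; lra. Qed.

Lemma c_range : / 4 <= c <= / 2.
Proof. by case: k_cases => -[_ ->]; lra. Qed.

Lemma pow2_subn : 2 ^ (n - k) = c * 2 ^ n.
Proof.
have kn : (k <= n)%N by case: k12 => ->; rewrite // ltnW.
rewrite -{2}(subnK kn) pow_add /c; field.
by have := pow2_gt0 k; lra.
Qed.

Lemma edge_measure_total : \rsum_i p i <= INR k * c * (1 + eps).
Proof.
apply: Rle_trans (edge_measure_sum_le A B) _.
have P := pow2_gt0 n; apply: (Rmult_le_reg_r (2 ^ n)) => //.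
rewrite /Rdiv Rmult_assoc Rinv_l; last lra.
by move: edges; rewrite pow2_subn; lra.
Qed.

Lemma uE : u = mu A + mu W.
Proof. by rewrite !muE -mean_add; apply: mean_ext => x; exact: chi_split. Qed.

Lemma u_bounds : c - c * eps <= u <= c + 3 / 2 * eps.
Proof.
have w0 := muW_ge0 W; have w1 := muW_le n2 muW; rewrite uE.
by move: muA_ge muA_le; rewrite -/c /c; case: k12 => -> /=; lra.
Qed.

Lemma variance_bound : c * (1 - c) - 3 / 2 * eps <= u * (1 - u).
Proof.
have := u_bounds; have := c_range.
have -> : u * (1 - u) = c * (1 - c) + (u - c) * (1 - c - u) by ring.
move: u => v cb vb.
(* With a = (3/2) eps, x = v - c and y = 1 - c - v, the two products (a + x)(1 + y) and (a - x)(1 -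
   y) sum to 2a + 2xy, whence xy >= -a. *)
have := Rmult_le_pos (3 / 2 * eps + (v - c)) (1 + (1 - c - v)) ltac:(nra) ltac:(nra).
have := Rmult_le_pos (3 / 2 * eps - (v - c)) (1 - (1 - c - v)) ltac:(nra) ltac:(nra).
lra.
Qed.

(** The majorants are [d] for [k = 1] and [(d + 1) / 2] for [k = 2]. The main terms of
    [single_direction] then cancel, at 1/2 and 3/8 respectively, leaving only [p i], [d i ^ 2] and
    multiples of [eps]. *)
Lemma edge_measure_le_sqr i : c * p i <= d i ^ 2 + 11 * c * eps.
Proof.
have V := variance_bound; have T := edge_measure_total; have Ale : mu A <= (1 + eps) * c := muA_le.
have S := single_direction AB AW BW ABW n2 muW.
have [[kE cE]|[kE cE]] := k_cases; rewrite kE cE in T V Ale *.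
  have := S 0 1 i ltac:(by move=> m; have := pw_le_id m; lra).
  by rewrite -/p -/u -/d; lra.
have h m : pw m <= / 2 + / 2 * INR m.
  by have := pw_le_half m; case: m => [|m]; lra.
have := S (/ 2) (/ 2) i h.
by rewrite -/p -/u -/d; lra.
Qed.

(** The main terms in [level1_bound] are 3/8 against 1/4 for [k = 1] and 9/32 against 7/32 for
    [k = 2]; twice the gap is [k c^2]. *)
Lemma level1_total : INR k * c ^ 2 - 9 * eps <= \rsum_i (d i ^ 2).
Proof.
have V := variance_bound; have T := edge_measure_total; have Ale : mu A <= (1 + eps) * c := muA_le.
have S := level1_bound AB AW BW ABW n2 muW.
have [[kE cE]|[kE cE]] := k_cases; rewrite kE cE in T V Ale *.
  have := S 0 (/ 2) ltac:(by move=> x; have := subavg_pw1 (~: B) (enum 'I_n) x; lra).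
  by rewrite -/p -/u -/d; lra.
have := S (1 / 8) (3 / 8) (subavg_pw2 (~: B) (enum 'I_n)).
by rewrite -/p -/u -/d; lra.
Qed.

Lemma half_mean_small i : c - 46 * eps <= p i ->
  exists b, half_mean (chi A) i (~~ b) <= 30 * eps.
Proof.
move=> pi; have := edge_measure_le_sqr i; have [_ u1] := u_bounds.
have cb := c_range.
have le b : half_mean (chi A) i b <= half_mean (chi (~: B)) i b.
  apply: mean_le => x; rewrite (chi_split AB AW BW ABW).
  have := chi01 W x; have := bR01 (x i == b); nra.
have := half_mean_sum (chi (~: B)) i; rewrite -/u /d /half_diff => us dd.
have lt := le true; have lf := le false.
set a := half_mean _ i true in us dd lt; set b := half_mean _ i false in us dd lf.
have [ab|ab] := Rle_lt_dec b a; [exists true|exists false] => /=.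
  (* 57 = 46 + 11, from [c p <= d^2 + 11 c eps]. As the two halves sum to at most [c + 3/2 eps], the
     smaller is at most [(57 + 3/2) / 2 * eps]. *)
  have : c - 57 * eps <= a - b by nra.
  by lra.
have : c - 57 * eps <= b - a by nra.
by lra.
Qed.

Lemma stability_small_eps :
  (exists I : {set 'I_n}, #|I| = k /\
     forall i, i \in I -> (1 - 2000 * eps) * 2 ^ (n - k) <= INR #|dir_boundary A i|) /\
  (exists C : {set cube n}, is_subcube_codim k C /\ mu (symdiff C A) <= 2000 * eps).
Proof.
have w0 := muW_ge0 W; have w1 := muW_le n2 muW.
have cb := c_range.
have p_bounds i : 0 <= p i <= c + eps.
  by have := edge_measure_bounds A B i; rewrite -/p; move: muA_le; rewrite -/c; nra.
have [J [Jk pJ]] := large_directions k12 (erefl c) eps0 (conj w0 w1)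
  (muW_sqr n2 muW ltac:(lra)) p_bounds edge_measure_total
  (half_diff_le AB AW BW ABW) edge_measure_le_sqr level1_total.
split.
  exists J; split=> // i iJ; apply: Rle_trans (dir_boundary_ge AB i).
  rewrite pow2_subn -Rmult_assoc; apply: Rmult_le_compat_r; first by left; exact: pow2_gt0.
  (* Since [c >= 1/4], the loss [46 eps] is at most [184 c eps]. *)
  by have := pJ i iJ; rewrite -/p; nra.
have /fin_all_exists[b bP] (i : 'I_n) : exists b, i \in J -> half_mean (chi A) i (~~ b) <= 30 * eps.
  have [iJ|_] := boolP (i \in J); last by exists true.
  by have [b] := half_mean_small (pJ i iJ); exists b.
exists [set x : cube n | [forall i in J, x i == finfun b i]]; split.
  by exists J, (finfun b).
apply: Rle_trans (symdiff_subcube_le _ _ _) _; rewrite Jk -/c.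
have : \rsum_(i <- enum J) half_mean (chi A) i (~~ (finfun b : cube n) i) <= \rsum_(i <- enum J) (30 * eps).
  by apply: rsum_le_in => i; rewrite mem_enum => iJ; rewrite ffunE; exact: bP.
rewrite rsum_const -cardE Jk.
have k2 : INR k <= 2 by case: k_cases; lra.
(* The total error is at most [c eps + 2 * 2 * 30 eps]. *)
by move: muA_ge; rewrite -/c; nra.
Qed.

End SmallEps.

Theorem theorem1p9 :
  exists K : R, (0 < K)%R /\
  forall (k n : nat) (eps : R) (A B W : {set cube n}),
    (k = 1 \/ k = 2)%N ->
    (2 <= n)%N ->
    (0 < eps)%R ->
    [disjoint A & B] -> [disjoint A & W] -> [disjoint B & W] ->
    A :|: B :|: W = setT ->
    ((1 - eps) * / 2 ^ k <= mu A)%R ->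
    (mu A <= (1 + eps) * / 2 ^ k)%R ->
    (mu W <= eps * Rpower (INR n) (- beta))%R ->
    (INR #|edge_boundary A B| < (1 + eps) * INR k * 2 ^ (n - k))%R ->
    (exists I : {set 'I_n}, #|I| = k /\
       forall i, i \in I ->
         ((1 - K * eps) * 2 ^ (n - k) <= INR #|dir_boundary A i|)%R)
    /\
    (exists C : {set cube n}, is_subcube_codim k C /\
       (mu (symdiff C A) <= K * eps)%R).
Proof.
(* For [eps > 1/2000] both conclusions are trivial: [1 - K * eps] is negative and [K * eps] exceeds
   1, so any [k] coordinates will do. *)
exists 2000%R; split; first lra.
move=> k n eps A B W k12 n2 eps0 AB AW BW ABW A1 A2 W1 E1.
have [small|big] := Rle_lt_dec eps (/ 2000).
  exact: (stability_small_eps k12 n2 (conj eps0 small) AB AW BW ABW A1 A2 W1 E1).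
have [J Jk] : exists J : {set 'I_n}, #|J| = k.
  by apply: card_subset_ord; case: k12 => ->; rewrite // ltnW.
split.
  exists J; split=> // i _.
  have := pos_INR #|dir_boundary A i|; have := pow2_gt0 (n - k); nra.
exists [set x : cube n | [forall i in J, x i == [ffun=> true] i]]; split.
  by exists J, [ffun=> true].
by apply: Rle_trans (mu_le1 _) _; lra.
Qed.
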